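(* Let $M>m>0$ be real numbers, let $\mathcal{H}$ be a complex Hilbert space and let $A\in\mathcal{B}(\mathcal{H})$. If $C_{M,m}(A)$ and $C_{M,m}(\mathrm{i}A^* )$ are accretive, then for any $0\le t\le 1$, $$(1-t)|A^*|+t|A|\le \frac{M+m}{2\sqrt{Mm}}\big((1-t)\,\mathfrak{I}A+t\,\mathfrak{R}A\big).$$
   Context: $\mathcal{B}(\mathcal{H})$ is the algebra of bounded linear operators on $\mathcal{H}$, with identity $I$. $C_{M,m}(T)=(MI-T^* )(T-mI)$; $|T|=(T^*T)^{1/2}$; $\mathfrak{R}T=\frac{T+T^*}{2}$ and $\mathfrak{I}T=\frac{T-T^*}{2\mathrm{i}}$. $T$ is accretive if $\mathfrak{R}T\ge 0$ (positive semi-definite). For self-adjoint $S,T$, $S\le T$ means $T-S$ is positive semi-definite. *)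

(* Defs.v *)
From HB Require Import structures.
From mathcomp Require Import all_boot all_order all_algebra.
From mathcomp Require Import complex.
From mathcomp Require Import all_classical all_reals all_analysis.

Set Implicit Arguments.
Unset Strict Implicit.
Unset Printing Implicit Defensive.

Import Order.TTheory GRing.Theory Num.Theory.
Import numFieldNormedType.Exports.
Local Open Scope classical_set_scope.
Local Open Scope ring_scope.
Local Open Scope complex_scope.

(* The norm of a normed module over R[i] takes values in R[i]. *)
HB.mixin Record isHilbert (R : realType) (H : Type)
    of CompleteNormedModule R[i] H := {
  inner : {dot H for (@Num.conj R[i])} ;
  innerE : forall x : H, inner x x = `|x| ^+ 2
}.

#[short(type="hilbertType")]
HB.structure Definition Hilbert (R : realType) :=
  {H of isHilbert R H & CompleteNormedModule R[i] H}.

Section Operators.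
Context {R : realType} {H : hilbertType R}.
Implicit Types (S T : H -> H) (x y : H).

(* Operators are plain functions, with the pointwise module structure of
   H -> H; bounded_operator is membership in the algebra B(H). *)
Definition bounded_operator T : Prop :=
  linear T /\ exists k : R, forall x, `|T x| <= k%:C * `|x|.

(* On B(H) the adjoint exists (Riesz representation) and is unique; the
   default value 0 is only relevant for functions outside B(H). *)
Definition adjoint T : H -> H :=
  xget 0 [set S | bounded_operator S /\
                  forall x y, inner (T x) y = inner x (S y)].

(* 0 <= z in R[i] means that z is real and nonnegative; in particular a
   positive bounded operator is self-adjoint. *)
Definition positive_operator T : Prop := forall x, 0 <= inner (T x) x.

Definition le_operator S T : Prop := positive_operator (T - S).

(* The unique positive square root of a positive T in B(H); the default
   value 0 is only relevant for other functions. *)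
Definition sqrt_operator T : H -> H :=
  xget 0 [set S | [/\ bounded_operator S, positive_operator S & S \o S = T]].

Definition abs_operator T : H -> H := sqrt_operator (adjoint T \o T).

Definition Re_operator T : H -> H := 2^-1 *: (T + adjoint T).

Definition Im_operator T : H -> H := (2 * 'i)^-1 *: (T - adjoint T).

Definition accretive T : Prop := positive_operator (Re_operator T).

Definition C_transform (M m : R) T : H -> H :=
  (M%:C *: idfun - adjoint T) \o (T - m%:C *: idfun).

End Operators.

(* Main.v *)
Require Import Defs.
From HB Require Import structures.
From mathcomp Require Import all_boot all_order all_algebra.
From mathcomp Require Import complex ring.
From mathcomp Require Import all_classical all_reals all_analysis.

Set Implicit Arguments.
Unset Strict Implicit.
Unset Printing Implicit Defensive.

Import Order.TTheory GRing.Theory Num.Theory.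
Import numFieldNormedType.Exports.
Local Open Scope ring_scope.
Local Open Scope complex_scope.

(** Write [T'] for the adjoint of [T].  Accretivity of [C_{M,m}(T)] says that
    [Re <T x - m x, M x - T x> >= 0] for all [x], which expands to
    [T'T + M m I <= (M + m) Re T] ([accretive_C_ineq]).  On the other side,
    [0 <= (|T| - c)^2] with [c = sqrt (M m)] gives
    [2 c |T| <= T'T + M m I] ([two_abs_le]), an operator form of the
    inequality between arithmetic and geometric means.  Chaining the two,
    [|T| <= (M + m) / (2 sqrt (M m)) Re T] ([abs_le_Re]).

    This is applied to [T = A] and to [T = i A'].  The adjoint of [i A'] is
    [- i A], so its real part is [Im A], and its modulus is [|A'|] because
    [(- i A) (i A') = A A'].  The theorem is the convex combination, with
    weights [t] and [1 - t], of the two inequalities.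

    The existence of [A'] is read off from the hypothesis on [A]
    ([accretive_C_has_adjoint]).  As for [|T|], the estimate is valid for
    every positive square root of [T'T] as well as for 0, hence for the value
    chosen by [sqrt_operator]. *)

(** * The inner product *)

Section Operators.
Context {R : realType} {H : hilbertType R}.
Implicit Types (S T U V : H -> H) (x y z : H) (a : R[i]).

Lemma innerDl x y z : inner (x + y) z = inner x z + inner y z.
Proof. exact: linearDl. Qed.

Lemma innerDr x y z : inner x (y + z) = inner x y + inner x z.
Proof. exact: linearDr. Qed.

Lemma innerBl x y z : inner (x - y) z = inner x z - inner y z.
Proof. exact: linearBl. Qed.

Lemma innerBr x y z : inner x (y - z) = inner x y - inner x z.
Proof. exact: linearBr. Qed.

Lemma innerZl a x y : inner (a *: x) y = a * inner x y.
Proof. exact: linearZl_LR. Qed.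

Lemma innerZr a x y : inner x (a *: y) = a^*%R * inner x y.
Proof. exact: (linearZr_LR inner). Qed.

Lemma inner_conj x y : inner x y = (inner y x)^*%R.
Proof. by rewrite hermC expr0 mul1r. Qed.

Lemma inner_ge0 x : 0 <= inner x x.
Proof. by rewrite innerE exprn_ge0. Qed.

Lemma inner_injr x y : (forall z, inner z x = inner z y) -> x = y.
Proof.
move=> exy; apply/eqP; rewrite -subr_eq0 -normr_eq0 -sqrf_eq0 -innerE.
by rewrite innerBr exy subrr.
Qed.

Lemma conj_real_complex (r : R) : (r%:C)^*%R = r%:C :> R[i].
Proof. exact: conjc_real. Qed.

(** * Bounded operators *)

(** A complex bound suffices, since its modulus is again a bound: the value
    [a * `|x|] dominates a norm, so it is real and nonnegative. *)
Lemma boundedP T : linear T -> (exists a, forall x, `|T x| <= a * `|x|) ->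
  bounded_operator T.
Proof.
move=> linT [a leT]; split=> //; exists (complex.Re `|a|) => x.
have a_ge0 : 0 <= a * `|x| by exact: le_trans (leT x).
by rewrite RRe_real ?normr_real// -[`|x|]normr_id -normrM ger0_norm.
Qed.

Lemma bounded_operatorD T x y : bounded_operator T -> T (x + y) = T x + T y.
Proof. by move=> [linT _]; rewrite -[x]scale1r linT !scale1r. Qed.

Lemma bounded_operatorZ a T x : bounded_operator T -> T (a *: x) = a *: T x.
Proof.
move=> bT; have T0 : T 0 = 0.
  by apply: (addIr (T 0)); rewrite -bounded_operatorD// addr0 add0r.
by have [linT _] := bT; rewrite -[_ *: x]addr0 linT T0 addr0.
Qed.

Lemma bounded_id : bounded_operator (idfun : H -> H).
Proof. by apply: boundedP => //; exists 1 => x; rewrite mul1r. Qed.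

Lemma boundedD S T :
  bounded_operator S -> bounded_operator T -> bounded_operator (S + T).
Proof.
move=> [linS [k leS]] [linT [l leT]]; apply: boundedP.
  by move=> a x y /=; rewrite !fctE linS linT scalerDr addrACA.
exists (k%:C + l%:C) => x; rewrite fctE mulrDl.
by rewrite (le_trans (ler_normD _ _))// lerD.
Qed.

Lemma boundedZ a T : bounded_operator T -> bounded_operator (a *: T).
Proof.
move=> [linT [l leT]]; apply: boundedP.
  by move=> b x y /=; rewrite !fctE linT scalerDr !scalerA mulrC.
by exists (`|a| * l%:C) => x; rewrite fctE normrZ -mulrA ler_wpM2l.
Qed.

Lemma bounded_comp S T :
  bounded_operator S -> bounded_operator T -> bounded_operator (S \o T).
Proof.
move=> [linS [k leS]] [linT [l leT]]; apply: boundedP.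
  by move=> b x y /=; rewrite linT linS.
exists (`|k|%:C * l%:C) => x /=; rewrite (le_trans (leS _))// -mulrA.
apply: (@le_trans _ _ (`|k|%:C * `|T x|)).
  by rewrite ler_wpM2r// lecR ler_norm.
by rewrite ler_wpM2l// ler0c.
Qed.

(** * Adjoints *)

(** Adjointness as a relation, so that adjoints of composite operators can be
    computed by exhibiting them. *)
Definition is_adjoint T S :=
  bounded_operator S /\ forall x y, inner (T x) y = inner x (S y).

Lemma is_adjointE T S : is_adjoint T S -> adjoint T = S.
Proof.
move=> adjS; apply: xget_unique => // S' [_ eS']; apply/funext => y.
by apply: inner_injr => x; rewrite -eS' (proj2 adjS).
Qed.

Lemma adjointP T S : is_adjoint T S -> is_adjoint T (adjoint T).
Proof. by move=> adjS; rewrite (is_adjointE adjS). Qed.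

Lemma is_adjointC T S :
  bounded_operator T -> is_adjoint T S -> is_adjoint S T.
Proof.
move=> bT [_ eTS]; split=> // x y.
by rewrite inner_conj -eTS -inner_conj.
Qed.

Lemma is_adjoint_id : is_adjoint (idfun : H -> H) idfun.
Proof. by split=> //; exact: bounded_id. Qed.

Lemma is_adjointD S S' T T' :
  is_adjoint T S -> is_adjoint T' S' -> is_adjoint (T + T') (S + S').
Proof.
move=> [bS eS] [bS' eS']; split; first exact: boundedD.
by move=> x y; rewrite !fctE innerDl innerDr eS eS'.
Qed.

Lemma is_adjointZ a S T : is_adjoint T S -> is_adjoint (a *: T) (a^*%R *: S).
Proof.
move=> [bS eS]; split; first exact: boundedZ.
by move=> x y; rewrite !fctE innerZl innerZr eS conjCK.
Qed.

Lemma is_adjointB S S' T T' :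
  is_adjoint T S -> is_adjoint T' S' -> is_adjoint (T - T') (S - S').
Proof.
move=> adjS /(is_adjointZ (-1)); rewrite rmorphN1 !scaleN1r.
exact: is_adjointD.
Qed.

Lemma is_adjoint_comp S S' T T' :
  is_adjoint T S -> is_adjoint T' S' -> is_adjoint (T \o T') (S' \o S).
Proof.
move=> [bS eS] [bS' eS']; split; first exact: bounded_comp.
by move=> x y /=; rewrite eS eS'.
Qed.

Lemma is_adjoint_scalar (r : R) :
  is_adjoint (r%:C *: (idfun : H -> H)) (r%:C *: idfun).
Proof.
by rewrite -{2}conj_real_complex; exact: is_adjointZ is_adjoint_id.
Qed.

(** Polarization: [D u v = <T u, v> - <u, T v>] is sesquilinear and vanishes
    on the diagonal, because [<T u, u>] is real.  Evaluating it at [x + y] and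
    [x + i y] shows that [D x y] is both the opposite of [D y x] and equal to
    it. *)
Lemma real_form_is_adjoint T : bounded_operator T ->
  (forall x, inner (T x) x \is Num.real) -> is_adjoint T T.
Proof.
move=> bT realT; split=> // x y.
pose D u v := inner (T u) v - inner u (T v).
have D0 u : D u u = 0.
  by rewrite /D (inner_conj u) (CrealP (realT u)) subrr.
have TD u v : T (u + v) = T u + T v by exact: bounded_operatorD.
have TZ a u : T (a *: u) = a *: T u by exact: bounded_operatorZ.
have D1 : D x y + D y x = 0.
  transitivity (D (x + y) (x + y) - D x x - D y y); last by rewrite !D0; ring.
  by rewrite /D !(TD, innerDl, innerDr); ring.
have D2 : 'i * (D y x - D x y) = 0.
  transitivity (D (x + 'i *: y) (x + 'i *: y) - D x x - ('i * - 'i) * D y y).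
    by rewrite /D !(TD, TZ, innerDl, innerDr, innerZl, innerZr) conjCi; ring.
  by rewrite !D0; ring.
move/eqP: D2; rewrite mulf_eq0 (negPf (neq0Ci _)) subr_eq0 => /eqP D2.
move/eqP: D1; rewrite D2 -mulr2n -mulr_natl mulf_eq0 pnatr_eq0 /=.
by rewrite subr_eq0 => /eqP.
Qed.

(** Suppose that [T] has no adjoint, so that [adjoint T] is 0 and the
    transform [C] is [M (T - m)].  An adjoint of [C] would yield one of [T],
    so [adjoint C] is 0 too, and accretivity of [C] says that [<C x, x>] is
    nonnegative.  But then [C] is self-adjoint by polarization, a
    contradiction. *)
Lemma accretive_C_has_adjoint (M m : R) T : M != 0 -> bounded_operator T ->
  accretive (C_transform M m T) -> is_adjoint T (adjoint T).
Proof.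
move=> M0 bT; have [[S adjS] _|nadjT] := pselect (exists S, is_adjoint T S).
  exact: adjointP adjS.
have adjT0 : adjoint T = 0.
  by apply: xgetPN => S adjS; apply: nadjT; exists S.
pose C := C_transform M m T.
have MC0 : M%:C != 0 :> R[i] by rewrite fmorph_eq0.
have CE : C = M%:C *: (T - m%:C *: idfun).
  by apply/funext => x; rewrite /C /C_transform adjT0 subr0.
have TE : T = (M^-1)%:C *: C + m%:C *: idfun.
  by rewrite CE scalerA -rmorphM mulVf// scale1r subrK.
have nadjC S : ~ is_adjoint C S.
  move=> adjC; apply: nadjT; eexists; rewrite TE.
  exact: is_adjointD (is_adjointZ _ adjC) (is_adjoint_scalar m).
have adjC0 : adjoint C = 0 by exact: xgetPN.
rewrite /accretive /Re_operator -/C adjC0 addr0 => posC.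
exfalso; apply: (nadjC C).
apply: real_form_is_adjoint => [|x].
  rewrite CE -scaleN1r; apply: boundedZ; apply: boundedD => //.
  by do 2!apply: boundedZ; exact: bounded_id.
have /ger0_real := posC x; rewrite fctE innerZl => /(rpredM (realn _ 2)).
by rewrite mulVKf ?pnatr_eq0.
Qed.

(** * Comparing the modulus with the real part *)

Lemma Re_operatorE T S x : is_adjoint T S ->
  inner (Re_operator T x) x = 2^-1 * (inner (T x) x + inner x (T x)).
Proof.
move=> adjS; rewrite /Re_operator (is_adjointE adjS) !fctE innerZl innerDl.
by rewrite [inner (S x) x]inner_conj -(proj2 adjS) -inner_conj.
Qed.

(** The form of [Re C_{M,m}(T)] at [x] is the real part of
    [<T x - m x, M x - T x>]; moving the factor [M - T'] across the inner
    product turns it into the difference of the two sides. *)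
Lemma accretive_C_ineq (M m : R) T : bounded_operator T ->
    is_adjoint T (adjoint T) -> accretive (C_transform M m T) ->
  forall x, inner (T x) (T x) + (M * m)%:C * inner x x <=
            (M + m)%:C * inner (Re_operator T x) x.
Proof.
move=> bT adjT accC x.
have adjMT : is_adjoint (M%:C *: idfun - adjoint T) (M%:C *: idfun - T).
  by apply: is_adjointB (is_adjoint_scalar M) (is_adjointC bT adjT).
have adjTm : is_adjoint (T - m%:C *: idfun) (adjoint T - m%:C *: idfun).
  exact: is_adjointB adjT (is_adjoint_scalar m).
have adjC := is_adjoint_comp adjMT adjTm.
rewrite (Re_operatorE x adjT) -subr_ge0.
have := accC x; rewrite (Re_operatorE x adjC).
congr (0 <= _).
rewrite /C_transform [inner x _]inner_conj (proj2 adjMT) -inner_conj !fctE.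
rewrite /= !(innerBl, innerBr, innerZl, innerZr) !conj_real_complex.
by rewrite rmorphM rmorphD; field.
Qed.

(** For [P = |T|], the difference of the two sides is [`|P x - c x|^2],
    because [P] is self-adjoint and [<P x, P x> = <P^2 x, x> = <T x, T x>]. *)
Lemma two_abs_le (c : R) T : is_adjoint T (adjoint T) ->
    forall x, 2 * c%:C * inner (abs_operator T x) x <=
  inner (T x) (T x) + c%:C ^+ 2 * inner x x.
Proof.
move=> adjT x; rewrite /abs_operator /sqrt_operator.
case: xgetP => [P _ [bP posP sqrP]|_]; last first.
  (* The default value 0: the right-hand side is a sum of squares. *)
  rewrite [X in inner X _](_ : _ = 0)// linear0l mulr0 addr_ge0 ?inner_ge0//.
  by rewrite mulr_ge0 ?inner_ge0// -rmorphXn ler0c sqr_ge0.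
have [_ adjP] := real_form_is_adjoint bP (fun y => ger0_real (posP y)).
have PPE : inner (P x) (P x) = inner (T x) (T x).
  by rewrite adjP (proj2 adjT) (congr1 (@^~ x) sqrP : P (P x) = _).
rewrite -PPE -subr_ge0; have := inner_ge0 (P x - c%:C *: x).
congr (0 <= _).
rewrite !(innerBl, innerBr, innerZl, innerZr) conj_real_complex.
(* Both cross terms must read [<P x, x>] to be collected. *)
by rewrite -[inner x (P x)]adjP; ring.
Qed.

(** Both [accretive_C_ineq] and [two_abs_le] compare with [T'T + M m I] once
    [c] is the geometric mean of [M] and [m]; divide the resulting inequality
    by [2 c]. *)
Lemma abs_le_Re (M m : R) T : 0 < m -> 0 < M -> bounded_operator T ->
    is_adjoint T (adjoint T) -> accretive (C_transform M m T) ->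
  le_operator (abs_operator T)
    (((M + m) / (2 * Num.sqrt (M * m)))%:C *: Re_operator T).
Proof.
move=> m0 M0 bT adjT accC x.
set c := Num.sqrt (M * m).
have c0 : 0 < c by rewrite sqrtr_gt0 mulr_gt0.
have cE : c%:C ^+ 2 = (M * m)%:C.
  by rewrite -rmorphXn sqr_sqrtr// ltW// mulr_gt0.
have := le_trans (two_abs_le c adjT x) _.
rewrite cE => /(_ _ (accretive_C_ineq bT adjT accC x)).
have c20 : 0 < 2 * c%:C :> R[i] by rewrite mulr_gt0// (ltcR 0).
set k := ((M + m) / _)%:C.
have <- : 2 * c%:C * k = (M + m)%:C.
  by rewrite /k fmorph_div rmorphM rmorph_nat mulrC divfK ?gt_eqF.
rewrite -[_ * k * _]mulrA (ler_pM2l c20) -subr_ge0 => le2.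
by rewrite innerBl innerZl.
Qed.

End Operators.

Theorem theorem2p3 (R : realType) (M m : R) (H : hilbertType R) (A : H -> H)
    (m_gt0 : 0 < m) (m_lt_M : m < M) (A_bounded : bounded_operator A)
    (C_A : accretive (C_transform M m A))
    (C_iA : accretive (C_transform M m ('i *: adjoint A)))
    (t : R) (t_ge0 : 0 <= t) (t_le1 : t <= 1) :
  le_operator
    ((1 - t)%:C *: abs_operator (adjoint A) + t%:C *: abs_operator A)
    (((M + m) / (2 * Num.sqrt (M * m)))%:C *:
       ((1 - t)%:C *: Im_operator A + t%:C *: Re_operator A)).
Proof.
have M_gt0 : 0 < M by exact: lt_trans m_lt_M.
have adjA := accretive_C_has_adjoint (lt0r_neq0 M_gt0) A_bounded C_A.
have adjA' := is_adjointC A_bounded adjA.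
pose B := 'i *: adjoint A.
have bB : bounded_operator B by apply: boundedZ; exact: (proj1 adjA).
have adjB : is_adjoint B (- 'i *: A).
  by rewrite -conjCi; exact: is_adjointZ.
have ReB : Re_operator B = Im_operator A.
  rewrite /Re_operator (is_adjointE adjB) /Im_operator invfM invCi -scalerA.
  by congr (_ *: _); rewrite scalerBr [- 'i *: adjoint A]scaleNr opprK addrC.
have absB : abs_operator B = abs_operator (adjoint A).
  rewrite /abs_operator (is_adjointE adjB) (is_adjointE adjA').
  congr sqrt_operator; apply/funext => x.
  rewrite /= /B !fctE (_ : A ('i *: _) = 'i *: A (adjoint A x)).
    by rewrite scalerA mulNr -expr2 sqrCi opprK scale1r.
  exact: bounded_operatorZ.
have leA := abs_le_Re m_gt0 M_gt0 A_bounded adjA C_A.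
have leB := abs_le_Re m_gt0 M_gt0 bB (adjointP adjB) C_iA.
move=> x; have := leA x; have := leB x; rewrite absB ReB.
set k := (_ / _)%:C.
rewrite !fctE !(innerBl, innerDl, innerZl) => leBx leAx.
have t0 : 0 <= t%:C :> R[i] by rewrite ler0c.
have t1 : 0 <= (1 - t)%:C :> R[i] by rewrite ler0c subr_ge0.
have := addr_ge0 (mulr_ge0 t1 leBx) (mulr_ge0 t0 leAx).
by congr (0 <= _); ring.
Qed.
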